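(* Let $G$ be a group, $N$ a normal subgroup of $G$, and $x \in [G,N]$. Then $$\mathrm{scl}_{G,N}(x) = \frac{1}{2} \sup_{f \in \mathrm{Q}^{\mathrm{h}}(N)^{G} \setminus \mathrm{H}^1(N)^{G}} \frac{|f(x)|}{D(f)},$$ where the right-hand side is regarded as $0$ if $\mathrm{Q}^{\mathrm{h}}(N)^{G} = \mathrm{H}^1(N)^{G}$.
   Context: Commutators are $[g,h]=ghg^{-1}h^{-1}$. For $N$ normal in $G$, a $(G,N)$-commutator is an element of the form $[g,h]$ with $g\in G$, $h\in N$; $[G,N]$ is the subgroup generated by all $(G,N)$-commutators. For $x\in[G,N]$, $\mathrm{cl}_{G,N}(x)$ is the minimal $n\ge 0$ such that $x$ is a product of $n$ $(G,N)$-commutators, and $\mathrm{scl}_{G,N}(x)=\lim_{n\to\infty}\mathrm{cl}_{G,N}(x^n)/n$ (the limit exists by Fekete's lemma). A function $f\colon N\to\mathbb{R}$ is a quasimorphism if its defect $D(f)=\sup_{a,b\in N}|f(ab)-f(a)-f(b)|$ is finite. It is homogeneous if $f(a^n)=n f(a)$ for all $a\in N$, $n\in\mathbb{Z}$. It is $G$-quasi-invariant if $\sup_{g\in G,a\in N}|f(gag^{-1})-f(a)|<\infty$, and $G$-invariant if $f(gag^{-1})=f(a)$ for all $g\in G$, $a\in N$. $\mathrm{Q}^{\mathrm{h}}(N)^G$ is the set of homogeneous $G$-quasi-invariant quasimorphisms on $N$ (for homogeneous quasimorphisms, $G$-quasi-invariance is the same as $G$-invariance). $\mathrm{H}^1(N)^G$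 is the set of $G$-invariant homomorphisms $N\to\mathbb{R}$. *)

(* Defs.v *)
From mathcomp Require Import all_boot all_order all_algebra.
From mathcomp Require Import all_classical all_reals all_analysis.

Set Implicit Arguments.
Unset Strict Implicit.
Unset Printing Implicit Defensive.
Import Order.TTheory GRing.Theory Num.Theory.
Import numFieldNormedType.Exports.

Local Open Scope classical_set_scope.
Local Open Scope ring_scope.

(* A subgroup N of G is a subGroupType: a group N with an injection           *)
(* val : N -> G that is a group morphism and whose image is {x | P x}.        *)

Section MixedCommutators.
Variables (G : groupType) (P : pred G) (N : subGroupType P).

Definition normal_subgroup : Prop :=
  forall (g : G) (a : N), P (g * val a * g^-1)%g.

(* MathComp's [~ g, h] is g^-1 h^-1 g h. *)
Definition comm (g h : G) : G := (g * h * g^-1 * h^-1)%g.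

Definition GNcomm : set G :=
  [set x | exists (g : G) (h : N), x = comm g (val h)].

Definition is_subgroup (H : set G) : Prop :=
  [/\ H 1%g, (forall a b, H a -> H b -> H (a * b)%g) & forall a, H a -> H a^-1%g].

Definition GNcommg : set G := smallest is_subgroup GNcomm.

Definition GNprod (n : nat) : set G :=
  [set x | exists2 c : 'I_n -> G,
     forall i, GNcomm (c i) & x = (\prod_(i < n) c i)%g].

(* xget picks the element of a singleton, and is 0 on the empty set, that is, *)
(* for x outside [G, N].                                                      *)
Definition cl (x : G) : nat :=
  xget 0%N [set n | GNprod n x /\ forall m, GNprod m x -> (n <= m)%N].

Definition scl (R : realType) (x : G) : R :=
  limn (fun n : nat => (cl (x ^+ n)%g)%:R / n%:R : R).

End MixedCommutators.

Section Quasimorphisms.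
Variables (R : realType) (N : groupType).
Implicit Type f : N -> R.

Definition defect f : \bar R :=
  ereal_sup [set (`|f (p.1 * p.2)%g - f p.1 - f p.2|)%:E | p in [set: N * N]].

Definition quasimorphism f : Prop := (defect f < +oo)%E.

Definition zexpg (a : N) (n : int) : N :=
  match n with Posz m => (a ^+ m)%g | Negz m => (a ^- m.+1)%g end.

Definition homogeneous f : Prop :=
  forall (a : N) (n : int), f (zexpg a n) = n%:~R * f a.

Definition homomorphism f : Prop := forall a b : N, f (a * b)%g = f a + f b.

End Quasimorphisms.

Section Invariance.
Variables (R : realType) (G : groupType) (P : pred G) (N : subGroupType P).
Variable nN : normal_subgroup N.

Definition conjN (g : G) (a : N) : N := Sub (g * val a * g^-1)%g (nN g a).

Definition Gquasi_invariant (f : N -> R) : Prop :=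
  (ereal_sup [set (`|f (conjN p.1 p.2) - f p.2|)%:E | p in [set: G * N]]
   < +oo)%E.

Definition Ginvariant (f : N -> R) : Prop :=
  forall (g : G) (a : N), f (conjN g a) = f a.

Definition Qh : set (N -> R) :=
  [set f | [/\ quasimorphism f, homogeneous f & Gquasi_invariant f]].

Definition H1 : set (N -> R) := [set f | homomorphism f /\ Ginvariant f].

End Invariance.

Arguments GNcommg {G P} N.
Arguments cl {G P} N x.
Arguments scl {G P} N R x.
Arguments Qh R {G P N} nN.
Arguments H1 R {G P N} nN.

(* Main.v *)
Require Import Defs.
From mathcomp Require Import all_boot all_order all_algebra.
From mathcomp Require Import all_classical all_reals all_analysis.
From mathcomp Require Import ring lra.

Set Implicit Arguments.
Unset Strict Implicit.
Unset Printing Implicit Defensive.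
Import Order.TTheory GRing.Theory Num.Theory.
Import numFieldNormedType.Exports.

Local Open Scope classical_set_scope.
Local Open Scope ring_scope.

(* Upper bound on |f(x)|/D(f): an invariant homogeneous quasimorphism f is    *)
(* bounded by D(f) on (G,N)-commutators, so |f| <= 2n D(f) on products of n   *)
(* of them; apply this to the powers of x.                                    *)
(*   Sharpness: integral chains c = sum_i n_i a_i over N carry a scl-like     *)
(* functional, the growth rate in k of the mixed commutator length of         *)
(* prod_i a_i^(k n_i). Reordering the factors changes this length by a bound  *)
(* independent of k, so the functional is sublinear, and a Hahn-Banach        *)
(* argument over Z yields f : N -> R, extended additively to chains, that is  *)
(* dominated by it and satisfies f(x) = scl(x). The chains a^n - n a and      *)
(* g a g^-1 - a have rate 0, which makes f homogeneous and G-invariant;       *)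
(* 2 a + 2 b - 2 ba has rate at most 1 because a^2k b^2k (ba)^-2k is a        *)
(* product of k commutators, so D(f) <= 1/2.                                  *)

(** The upper bound is [Qh_scl]: |f(x)| <= 2 D(f) scl(x). The extremal f comes from
    [dominated_total], applied to the one-point assignment that [dominated_scl] shows to be
    dominated. [dominated_Qh] reads homogeneity, invariance and D(f) <= 1/2 off explicit fillings,
    the constant coming from [GNprod_pants]. For this f with f(x) = scl(x), the upper bound is an
    equality. If f is a homomorphism, then D(f) = 0 and the same bound forces scl(x) = 0, which
    settles the degenerate cases. *)

Section Zexpg.
Variable N : groupType.
Implicit Types (a b g : N) (m n : int).

Lemma zexpgN a n : zexpg a (- n) = (zexpg a n)^-1%g.
Proof.
case: n => [[|n]|n]; first by rewrite oppr0 /= expg0 invg1.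
  by rewrite -NegzE.
by rewrite NegzE opprK /= invgK.
Qed.

Lemma zexpgDnat a (i j : nat) : zexpg a (i%:Z - j%:Z) = (a ^+ i * a ^- j)%g.
Proof.
case: (leqP j i) => [le_ji|/ltnW le_ij].
  by rewrite subzn //= expgnFr.
rewrite -[_ - _]opprB subzn // zexpgN /= expgnFr //.
by rewrite invgF.
Qed.

Lemma zexpgD a m n : zexpg a (m + n) = (zexpg a m * zexpg a n)%g.
Proof.
have splitz (k : int) : exists i j : nat, k = i%:Z - j%:Z.
  by case: k => k; [exists k, 0%N | exists 0%N, k.+1];
    rewrite ?subr0 // sub0r NegzE.
have [i [j ->]] := splitz m; have [i' [j' ->]] := splitz n.
have -> : i%:Z - j%:Z + (i'%:Z - j'%:Z) = (i + i')%:Z - (j + j')%:Z.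
  by rewrite !PoszD; ring.
rewrite !zexpgDnat [(j + j')%N]addnC !expgnDr invgM -!mulgA; congr (_ * _)%g.
rewrite !mulgA; congr (_ * _)%g.
apply: commuteV; apply: commuteX2; exact: commute_refl.
Qed.

Lemma zexpg_commute a m n : commute (zexpg a m) (zexpg a n).
Proof. by rewrite /commute -!zexpgD addrC. Qed.

Lemma expg_conj g a (n : nat) : ((g * a * g^-1) ^+ n = g * a ^+ n * g^-1)%g.
Proof.
elim: n => [|n IH]; first by rewrite !expg0 mulg1 mulgV.
by rewrite !expgS IH !mulgA mulgVK.
Qed.

Lemma expg_shift a b (n : nat) : (a * (b * a) ^+ n = (a * b) ^+ n * a)%g.
Proof.
elim: n => [|n IH]; first by rewrite !expg0 mulg1 mul1g.
by rewrite [in LHS]expgSr mulgA IH expgSr !mulgA.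
Qed.

End Zexpg.

(** * Products of (G,N)-commutators *)

Section Products.
Variables (G : groupType) (P : pred G) (N : subGroupType P).
Variable nN : normal_subgroup N.
Implicit Types (x y z g : G) (a b : N).

Lemma val_inv a : val a^-1%g = (val a)^-1%g.
Proof. exact: gmulfV. Qed.

Lemma val_expg a n : val (a ^+ n)%g = (val a ^+ n)%g.
Proof. exact: gmulfXn. Qed.

Lemma val_conjN g a : val (conjN nN g a) = (g * val a * g^-1)%g.
Proof. exact: SubK. Qed.

Lemma GNprod0 : GNprod N 0 1%g.
Proof. by exists (fun=> 1%g) => [[]|]//; rewrite big_ord0. Qed.

Lemma GNprodS n y :
  GNprod N n.+1 y <-> exists c z, [/\ GNcomm N c, GNprod N n z & y = (c * z)%g].
Proof.
split=> [[c cP ->]|[c [_ [cP [d dP ->] ->]]]].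
  exists (c ord0), (\prod_(i < n) c (lift ord0 i))%g; split=> //.
    by exists (fun i => c (lift ord0 i)).
  by rewrite big_ord_recl.
exists (fun i => if unlift ord0 i is Some j then d j else c) => [i|].
  by case: unliftP.
rewrite big_ord_recl unlift_none; congr (_ * _)%g.
by apply: eq_bigr => i _; rewrite liftK.
Qed.

Lemma GNprodM m n y z : GNprod N m y -> GNprod N n z -> GNprod N (m + n) (y * z)%g.
Proof.
elim: m y => [|m IH] y.
  by case=> c _ ->; rewrite big_ord0 mul1g.
move=> /GNprodS[c [w [cP wP ->]]] zP.
by apply/GNprodS; exists c, (w * z)%g; rewrite mulgA; split => //; apply: IH.
Qed.

Lemma GNprod1 c : GNcomm N c -> GNprod N 1 c.
Proof.
move=> cP; apply/GNprodS; exists c, 1%g.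
by split=> //; [exact: GNprod0|rewrite mulg1].
Qed.

Lemma GNcomm_conj g c : GNcomm N c -> GNcomm N (g * c * g^-1)%g.
Proof.
move=> [h [a ->]]; exists (g * h * g^-1)%g, (conjN nN g a).
by rewrite /comm val_conjN !invgM !invgK !mulgA !mulgVK.
Qed.

(** By normality, a g a^-1 g^-1 = [g^-1, g a g^-1]. *)
Lemma GNcommV c : GNcomm N c -> GNcomm N c^-1%g.
Proof.
move=> [g [a ->]]; exists g^-1%g, (conjN nN g a).
by rewrite /comm val_conjN !invgM !invgK !mulgA mulVg mul1g mulgVK.
Qed.

Lemma GNprod_conj n g y : GNprod N n y -> GNprod N n (g * y * g^-1)%g.
Proof.
elim: n y => [|n IH] y.
  by case=> c _ ->; rewrite big_ord0 mulg1 mulgV; exact: GNprod0.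
move=> /GNprodS[c [z [cP zP ->]]]; apply/GNprodS.
exists (g * c * g^-1)%g, (g * z * g^-1)%g; split; last by rewrite !mulgA mulgVK.
  exact: GNcomm_conj.
exact: IH.
Qed.

Lemma GNprodV n y : GNprod N n y -> GNprod N n y^-1%g.
Proof.
elim: n y => [|n IH] y.
  by case=> c _ ->; rewrite big_ord0 invg1; exact: GNprod0.
move=> /GNprodS[c [z [cP zP ->]]]; rewrite invgM -addn1; apply: GNprodM (IH _ zP) _.
exact/GNprod1/GNcommV.
Qed.

Lemma GNprodX m n y : GNprod N n y -> GNprod N (m * n) (y ^+ m)%g.
Proof.
move=> yP; elim: m => [|m IH]; first by rewrite expg0; exact: GNprod0.
by rewrite mulSn expgS; exact: GNprodM.
Qed.

Lemma GNcommgP y : GNcommg N y -> exists n, GNprod N n y.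
Proof.
move=> yP; apply: (yP [set y | exists n, GNprod N n y]); split; last first.
  by move=> c /GNprod1; exists 1%N.
split; first by exists 0%N; exact: GNprod0.
  by move=> a b [m aP] [n bP]; exists (m + n)%N; exact: GNprodM.
by move=> a [m aP]; exists m; exact: GNprodV.
Qed.

Lemma clP y : (exists n, GNprod N n y) ->
  GNprod N (cl N y) y /\ forall m, GNprod N m y -> (cl N y <= m)%N.
Proof.
move=> [n yP]; rewrite /cl; case: xgetP => [k _ //|noP].
have exP : exists n, `[< GNprod N n y >] by exists n; exact/asboolP.
exfalso; apply: (noP (ex_minn exP)); case: ex_minnP => m /asboolP mP minm.
split=> // k kP.
by apply: minm; apply/asboolP.
Qed.

(* a q b a^-1 s b^-1 = [a q, b q] (b (q s) b^-1): with q = a^m b^m and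
   s = (b^-1 a^-1)^m, m = 2n + 1, one commutator lowers the exponent by two. *)
Lemma GNprod_pants (a b : N) n :
  GNprod N n (val (a ^+ n.*2 * b ^+ n.*2 * (a^-1 * b^-1) ^+ n.*2)%g).
Proof.
elim: n => [|n IH]; first by rewrite !expg0 !mulg1 val1; exact: GNprod0.
pose q := (a ^+ n.*2.+1 * b ^+ n.*2.+1)%g.
pose s := ((b^-1 * a^-1) ^+ n.*2.+1)%g.
have -> : (a ^+ n.+1.*2 * b ^+ n.+1.*2 * (a^-1 * b^-1) ^+ n.+1.*2 =
           comm (a * q) (b * q) * (b * (q * s) * b^-1))%g.
  have -> : ((a^-1 * b^-1) ^+ n.+1.*2 = a^-1 * s * b^-1)%g.
    by rewrite doubleS expgSr mulgA -expg_shift.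
  rewrite doubleS [(a ^+ _.+2)%g]expgS [(b ^+ _.+2)%g]expgSr /comm !invgM !mulgA.
  by rewrite !(mulgK, mulgVK).
have -> : (q * s = a * (a ^+ n.*2 * b ^+ n.*2 * (a^-1 * b^-1) ^+ n.*2) * a^-1)%g.
  rewrite /q /s expgS [(b ^+ _)%g]expgSr [((b^-1 * _) ^+ _)%g]expgS -!mulgA mulVKg.
  by rewrite expg_shift.
rewrite [val _]valM [val (b * _ * _)%g]valM [val (b * _)%g]valM val_inv.
rewrite [val (a * _ * _)%g]valM [val (a * _)%g]valM val_inv.
rewrite -add1n; apply: GNprodM; last by do 2 apply: GNprod_conj.
apply: GNprod1; exists (val (a * q)%g), (b * q)%g.
by rewrite /comm !(valM, val_inv).
Qed.

End Products.

(** * Integral chains over N and their filling rates *)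

Section Chains.
Variables (R : realType) (G : groupType) (P : pred G) (N : subGroupType P).
Variable nN : normal_subgroup N.
Implicit Types (c l : seq (N * R * int)) (t : R) (k : nat).

(* A term (a, r, n) stands for n copies of the element a, to which the
   functional under construction gives the value r. *)
Definition chain_pow k c : N := (\prod_(e <- c) zexpg e.1.1 e.2 ^+ k)%g.

Definition chain_eval c : R := \sum_(e <- c) e.2%:~R * e.1.2.

(** The reversal makes [chain_pow] of the opposite chain the exact inverse, with no reordering. *)
Definition chain_opp c := rev [seq (e.1, - e.2) | e <- c].

(** Epigraph of the scl-like functional: t bounds the growth rate, and a chain with no filling
    simply has no t. The constant K absorbs costs independent of k. *)
Definition filling_bound c t := exists K : R, forall k,
  exists2 n, GNprod N n (val (chain_pow k c)) & n%:R <= t * k%:R + K.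

Lemma chain_eval_cat c l : chain_eval (c ++ l) = chain_eval c + chain_eval l.
Proof. by rewrite /chain_eval big_cat. Qed.

Lemma chain_eval_cons e l : chain_eval (e :: l) = e.2%:~R * e.1.2 + chain_eval l.
Proof. by rewrite /chain_eval big_cons. Qed.

Lemma chain_eval_opp c : chain_eval (chain_opp c) = - chain_eval c.
Proof.
rewrite /chain_eval /chain_opp big_rev big_map -sumrN.
by apply: eq_bigr => e _; rewrite mulrNz mulNr.
Qed.

Lemma chain_pow_cat k c l : chain_pow k (c ++ l) = (chain_pow k c * chain_pow k l)%g.
Proof. by rewrite /chain_pow big_cat. Qed.

Lemma chain_pow_cons k e l :
  chain_pow k (e :: l) = (zexpg e.1.1 e.2 ^+ k * chain_pow k l)%g.
Proof. by rewrite /chain_pow big_cons. Qed.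

Lemma chain_pow_opp k c : chain_pow k (chain_opp c) = (chain_pow k c)^-1%g.
Proof.
elim: c => [|e c IH]; first by rewrite /chain_pow !big_nil invg1.
rewrite /chain_opp /= rev_cons -cats1 chain_pow_cat IH !chain_pow_cons invgM.
by rewrite /chain_pow big_nil mulg1 zexpgN expVgn.
Qed.

Lemma filling_bound0 c K :
  (forall k, GNprod N K (val (chain_pow k c))) -> filling_bound c 0.
Proof. by move=> cP; exists K%:R => k; exists K; rewrite // mul0r add0r. Qed.

Lemma filling_bound_nil : filling_bound [::] 0.
Proof.
by apply: (@filling_bound0 _ 0) => k; rewrite /chain_pow big_nil val1; exact: GNprod0.
Qed.

Lemma filling_bound_coef0 v r c t :
  filling_bound ((v, r, 0) :: c) t <-> filling_bound c t.
Proof.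
have powE k : chain_pow k ((v, r, 0) :: c) = chain_pow k c.
  by rewrite chain_pow_cons /= expg0 expg1n mul1g.
by split=> -[K cP]; exists K => k; have := cP k; rewrite powE.
Qed.

Lemma filling_bound_cat c l t s :
  filling_bound c t -> filling_bound l s -> filling_bound (c ++ l) (t + s).
Proof.
move=> [K cP] [L lP]; exists (K + L) => k.
have [m mP mK] := cP k; have [n nP nL] := lP k.
exists (m + n)%N; last by rewrite natrD; lra.
by rewrite chain_pow_cat valM; exact: GNprodM.
Qed.

Lemma filling_bound_opp c t : filling_bound c t -> filling_bound (chain_opp c) t.
Proof.
move=> [K cP]; exists K => k; have [n nP nK] := cP k; exists n => //.
by rewrite chain_pow_opp val_inv; exact: GNprodV.
Qed.

(* Moving the k-th power of v across the product of l costs one commutator,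
   whatever k is. *)
Lemma filling_bound_merge v r s l c i j t :
  filling_bound ((v, r, i) :: l ++ (v, s, j) :: c) t ->
  filling_bound ((v, r, i + j) :: l ++ c) t.
Proof.
move=> [K cP]; exists (K + 1) => k; have [n nP nK] := cP k.
exists (1 + n)%N; last by rewrite natrD; lra.
move: nP; rewrite !chain_pow_cons !chain_pow_cat chain_pow_cons /= zexpgD.
rewrite expgMn; last exact: zexpg_commute.
set x := (zexpg v i ^+ k)%g; set y := (zexpg v j ^+ k)%g.
set L := chain_pow k l; set C := chain_pow k c => nP.
have -> : (x * y * (L * C) = (x * comm L y * x^-1)^-1 * (x * (L * (y * C))))%g.
  by rewrite /comm !invgM !invgK !mulgA !(mulgVK, mulgK).
rewrite valM; apply: GNprodM => //; rewrite val_inv 2!valM val_inv.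
apply/GNprodV/GNprod_conj/GNprod1 => //; exists (val L), y.
by rewrite /comm !(valM, val_inv).
Qed.

End Chains.

(** * Hahn-Banach extension over Z *)

(** One-dimensional step of Hahn-Banach. Positive degrees bound r above and negative ones bound it
    below; suitable multiples of two such constraints add up to degree 0, where nonnegativity makes
    them compatible. *)
Lemma additive_separation (R : realType) (T : int -> R -> Prop) :
  (forall i j w z, T i w -> T j z -> T (i + j) (w + z)) ->
  (forall w, T 0 w -> 0 <= w) ->
  (forall j w, T j w -> exists z, T (- j) z) ->
  exists r, forall j w, T j w -> j%:~R * r <= w.
Proof.
move=> TD T0 TN.
have TM n j w : 0 < n -> T j w -> T (n * j) (n%:~R * w).
  case: n => // [[//|n]] _ jw; elim: n => [|n IH]; first by rewrite !mul1r.
  by rewrite -addn1 PoszD intrD !mulrDl !mul1r; exact: TD.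
pose A := [set r : R | exists j w, [/\ 0 < j, T (- j) w & r = - w / j%:~R]].
have A_ub i z : 0 < i -> T i z -> ubound A (z / i%:~R).
  move=> i0 iz _ [j [w [j0 jw ->]]].
  rewrite ler_pdivrMr ?ltr0z // mulrAC ler_pdivlMr ?ltr0z //.
  have := TD _ _ _ _ (TM _ _ _ j0 iz) (TM _ _ _ i0 jw).
  by rewrite mulrN mulrC subrr => /T0; lra.
have [[r0 Ar0]|A0] := pselect (A !=set0); last first.
  (* [T] has no negative degree, hence by [TN] no positive one, and any r works. *)
  exists 0 => j w jw; rewrite mulr0; case: (ltgtP j 0) => [j0|j0|j0].
  - by exfalso; apply: A0; exists (- w / (- j)%:~R), (- j), w; rewrite opprK oppr_gt0.
  - by exfalso; apply: A0; have [z jz] := TN _ _ jw; exists (- z / j%:~R), j, z.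
  - by apply: T0; rewrite -j0.
have [j0 [w0 [j0_gt0 /TN[z0 +] _]]] := Ar0; rewrite opprK => jz0.
have supA : has_sup A by split; [exists r0|exists (z0 / j0%:~R); exact: A_ub].
exists (sup A) => j w jw; case: (ltgtP j 0) => [j_lt0|j_gt0|j_eq0].
- have : - w / (- j)%:~R <= sup A.
    by apply: ub_le_sup; [case: supA|exists (- j), w; rewrite opprK oppr_gt0].
  by rewrite ler_pdivrMr ?ltr0z ?oppr_gt0 // mulrNz mulrN lerN2 mulrC.
- have : sup A <= w / j%:~R by apply: ge_sup; [case: supA|exact: A_ub].
  by rewrite ler_pdivlMr ?ltr0z // mulrC.
- by rewrite j_eq0 mul0r; apply: T0; rewrite -j_eq0.
Qed.

Section Extension.
Variables (R : realType) (G : groupType) (P : pred G) (N : subGroupType P).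
Variable nN : normal_subgroup N.
Implicit Types (c l : seq (N * R * int)) (t : R) (k : nat) (X Y : set (N * R)).

Definition chain_over X c := {in c, forall e, X e.1}.

Definition dominated X := forall c t,
  chain_over X c -> filling_bound c t -> chain_eval c <= t.

Lemma chain_over_cat X c l :
  chain_over X c -> chain_over X l -> chain_over X (c ++ l).
Proof. by move=> cX lX e; rewrite mem_cat => /orP[/cX|/lX]. Qed.

Lemma chain_over_opp X c : chain_over X c -> chain_over X (chain_opp c).
Proof. by move=> cX e; rewrite mem_rev => /mapP[e' /cX ? ->]. Qed.

(** A value r at v is admissible when j r + [chain_eval l] <= t whenever j v + l has filling bound
    t, so r must satisfy j r <= w for every [T j w]. *)
Lemma dominated_extend X (v : N) :
  dominated X -> exists r, dominated (X `|` [set (v, r)]).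
Proof.
move=> domX.
pose T j w := exists l t,
  [/\ chain_over X l, filling_bound ((v, 0, j) :: l) t & w = t - chain_eval l].
have TD i j w z : T i w -> T j z -> T (i + j) (w + z).
  move=> [l [t [lX lt ->]]] [m [s [mX ms ->]]].
  exists (l ++ m), (t + s); split; first exact: chain_over_cat.
    exact/(filling_bound_merge nN (v := v) (s := 0))/(filling_bound_cat lt ms).
  by rewrite chain_eval_cat; ring.
have T0 w : T 0 w -> 0 <= w.
  by move=> [l [t [lX /filling_bound_coef0 lt ->]]]; rewrite subr_ge0; exact: domX.
have TN j w : T j w -> exists z, T (- j) z.
  move=> [l [t [lX lt _]]]; exists (t - chain_eval (chain_opp l)), (chain_opp l), t.
  split=> //; first exact: chain_over_opp.
  have := filling_bound_cat (filling_bound_nil R N) (filling_bound_opp nN lt).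
  rewrite /chain_opp /= rev_cons -cats1 add0r => bd.
  (* Negation has moved v to the end of the chain; merging it into a zero term put in front brings
     it back to the head. *)
  have := @filling_bound_merge _ _ _ _ nN v 0 0 (chain_opp l) [::] 0 (- j) t.
  rewrite add0r cats0; apply.
  exact/filling_bound_coef0.
have [r rP] := additive_separation TD T0 TN; exists r.
(* Induction sorts a chain: l collects the terms over X, j the total coefficient of v. *)
suff ext c l j t : chain_over X l -> chain_over (X `|` [set (v, r)]) c ->
    filling_bound ((v, r, j) :: l ++ c) t ->
    chain_eval l + j%:~R * r + chain_eval c <= t.
  move=> c t cX ct; have := ext c [::] 0 t; rewrite mul0r /chain_eval big_nil !add0r.
  by apply=> //; exact/filling_bound_coef0.
elim: c l j => [|e c IH] l j lX cX.
  rewrite cats0 => lt; rewrite /chain_eval big_nil addr0 addrC -lerBrDr.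
  (* [chain_pow] ignores values, so r may be replaced by the dummy 0 used in [T]. *)
  apply: rP; exists l, t; split=> //; move: lt; rewrite /filling_bound => -[K lK].
  by exists K => k; have := lK k; rewrite !chain_pow_cons.
have cX' : chain_over (X `|` [set (v, r)]) c.
  by move=> e' e'c; apply: cX; rewrite inE e'c orbT.
have [Xe|/= ev] : (X `|` [set (v, r)]) e.1 by apply: cX; rewrite inE eqxx.
  have lX' : chain_over X (rcons l e).
    by move=> e'; rewrite mem_rcons inE => /orP[/eqP->//|/lX].
  rewrite -cat_rcons => /(IH _ _ lX' cX').
  rewrite chain_eval_cons -cats1 chain_eval_cat chain_eval_cons.
  by rewrite [chain_eval [::]]/chain_eval big_nil; lra.
case: e ev {cX} => [_ i] /= -> /(filling_bound_merge nN) /(IH _ _ lX cX').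
by rewrite chain_eval_cons /= intrD; lra.
Qed.

Lemma dominatedS X Y : X `<=` Y -> dominated Y -> dominated X.
Proof. by move=> XY domY c t cX; apply: domY => e /cX/XY. Qed.

(** The chain v - v has rate 0 whatever values are attached to its two terms. *)
Lemma dominated_functional X (v : N) r s :
  dominated X -> X (v, r) -> X (v, s) -> r = s.
Proof.
move=> domX; suff le r' s' : X (v, r') -> X (v, s') -> r' <= s'.
  by move=> vr vs; apply/eqP; rewrite eq_le !le.
move=> vr vs; rewrite -subr_ge0.
have : chain_eval [:: (v, r', 1); (v, s', - 1)] <= 0.
  apply: domX => [e|]; first by rewrite !inE => /orP[]/eqP->.
  apply: (@filling_bound0 _ _ _ _ _ 0) => k.
  rewrite !chain_pow_cons zexpgN expVgn mulVKg /chain_pow big_nil val1.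
  exact: GNprod0.
by rewrite !chain_eval_cons /chain_eval big_nil /=; lra.
Qed.

Lemma dominated_total X : dominated X -> exists f : N -> R,
  (forall v r, X (v, r) -> f v = r) /\ dominated [set p | p.2 = f p.1].
Proof.
move=> domX.
(* Zorn on the sets added to X; [set0] below covers the empty family. *)
have [|Y [domY maxY]] := @Zorn_bigcup _ [set Y | dominated (X `|` Y)].
  move=> F Fdom Ftot c t cF ct.
  suff [Y [FY cY]] : exists Y, (Y = set0 \/ F Y) /\ chain_over (X `|` Y) c.
    case: FY cY => [->|/Fdom domY]; last by move=> /domY; apply.
    by rewrite setU0 => /domX; apply.
  elim: c {ct} cF => [_|e c IH ecF]; first by exists set0; split; [left|].
  have [|Y [FY cY]] := IH.
    by move=> e' e'c; apply: ecF; rewrite inE e'c orbT.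
  have ecover Z : (X `|` Z) e.1 -> chain_over (X `|` Z) c ->
      chain_over (X `|` Z) (e :: c).
    by move=> Ze cZ e'; rewrite inE => /orP[/eqP->|/cZ].
  have [Xe|[Z FZ Ze]] := ecF e (mem_head _ _).
    by exists Y; split => //; apply: ecover => //; left.
  have [YZ|ZY] : Y `<=` Z \/ Z `<=` Y.
    by case: FY => [->|FY]; [left; exact: sub0set|exact: Ftot].
    exists Z; split; [by right|apply: ecover; first by right].
    by move=> e' /cY; apply: setUS.
  by exists Y; split => //; apply: ecover => //; right; apply: ZY.
(* A point without a value would allow a proper extension, against maximality. *)
have Ytot v : exists r, Y (v, r).
  have [r] := dominated_extend v domY; rewrite -setUA => domYr.
  exists r; apply: contrapT => Yvr; apply: (maxY _ _ domYr); split; first by left.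
  by move=> /(_ (v, r)) H; apply/Yvr/H; right.
have [f fY] := choice Ytot; exists f; split.
  by move=> v r Xvr; apply: (@dominated_functional _ v _ _ domY); [right|left].
by apply: dominatedS domY => -[v r] /= ->; right.
Qed.
End Extension.

(** * Asymptotic slopes and subadditive sequences *)

Lemma le_slope (R : realType) (a t K : R) :
  (forall k : nat, a * k%:R <= t * k%:R + K) -> a <= t.
Proof.
move=> aP; rewrite leNgt; apply/negP; rewrite -subr_gt0 => ta.
have := aP (Num.truncn (K / (a - t))).+1; have := truncnS_gt (K / (a - t)).
by rewrite ltr_pdivrMr //; nra.
Qed.

Lemma fekete (R : realType) (u : nat -> R) :
  (forall n, 0 <= u n) -> (forall m n, u (m + n)%N <= u m + u n) ->
  exists l : R, (u n / n%:R @[n --> \oo] --> l) /\ forall n, l * n%:R <= u n.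
Proof.
move=> u0 uD; pose A := [set u n / n%:R | n in [set n | (0 < n)%N]].
have A0 : lbound A 0 by move=> _ [n n0 <-]; rewrite divr_ge0.
have infA : has_inf A by split; [exists (u 1%N / 1%:R), 1%N|exists 0].
have inf_le n : (0 < n)%N -> inf A * n%:R <= u n.
  by move=> n0; rewrite -ler_pdivlMr ?ltr0n //; apply: ge_inf; [case: infA|exists n].
exists (inf A); split; last first.
  by case=> [|n]; [rewrite mulr0|exact: inf_le].
apply/cvgrPdist_le => e e0.
have [_ [m m0 <-] um] : exists2 y, A y & y < inf A + e / 2.
  by apply: inf_adherent => //; rewrite divr_gt0.
(* [B] bounds [u] at all remainders modulo m at once. *)
pose B := \sum_(r < m) u r.
have uM q n : u (q * m + n)%N <= q%:R * u m + u n.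
  elim: q => [|q IH]; first by rewrite mul0r add0r.
  by rewrite mulSn -addnA (le_trans (uD _ _)) // mulrSr; lra.
have u_le n : u n <= u m / m%:R * n%:R + B.
  rewrite {1}(divn_eq n m) (le_trans (uM _ _)) //; apply: lerD.
    rewrite mulrAC ler_pdivlMr ?ltr0n // -mulrA [u m * _]mulrC mulrA.
    by rewrite -natrM mulrC ler_wpM2l // ler_nat leq_trunc_div.
  rewrite /B (bigD1 (Ordinal (ltn_pmod n m0))) //= lerDl.
  by apply: sumr_ge0.
near=> n.
have n0 : (0 < n)%N by near: n; exact: nbhs_infty_gt.
have Bn : B <= e / 2 * n%:R.
  rewrite mulrC -ler_pdivrMr ?divr_gt0 //; near: n.
  exact: nbhs_infty_ger.
rewrite distrC ger0_norm ?subr_ge0 ?ler_pdivlMr ?ltr0n ?inf_le //.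
rewrite lerBlDr ler_pdivrMr ?ltr0n // (le_trans (u_le n)) //.
have : u m / m%:R * n%:R <= (inf A + e / 2) * n%:R by rewrite ler_wpM2r // ltW.
lra.
Unshelve. all: by end_near.
Qed.

(** * The limit defining scl, and the starting point of the extension *)

Section SclBounds.
Variables (R : realType) (G : groupType) (P : pred G) (N : subGroupType P).
Variable nN : normal_subgroup N.

Lemma sclP (y : G) : (exists n, GNprod N n y) ->
  (((cl N (y ^+ n)%g)%:R / n%:R : R) @[n --> \oo] --> scl N R y) /\
  forall n, scl N R y * n%:R <= (cl N (y ^+ n)%g)%:R.
Proof.
move=> [m yP].
have yX n : exists k, GNprod N k (y ^+ n)%g by exists (n * m)%N; exact: GNprodX.
have [||l [ul lu]] := @fekete R (fun n => (cl N (y ^+ n)%g)%:R).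
- by [].
- move=> i j; rewrite -natrD ler_nat; apply: (clP (yX _)).2.
  by rewrite expgnDr; apply: GNprodM; apply: (clP (yX _)).1.
by have -> : scl N R y = l by apply/cvg_lim.
Qed.

Lemma scl_ge0 (y : G) : (exists n, GNprod N n y) -> 0 <= scl N R y.
Proof.
move=> /sclP[yl _]; rewrite -(cvg_lim _ yl) //.
apply: limr_ge; first by apply/cvg_ex; exists (scl N R y).
by apply: nearW => n; rewrite divr_ge0.
Qed.

Lemma dominated_scl (x : N) : (exists n, GNprod N n (val x)) ->
  dominated [set (x, scl N R (val x))].
Proof.
move=> xP c t cx [K cK]; set s := scl _ _ _ in cx *.
have [J [evJ powJ]] : exists J, chain_eval c = J%:~R * s /\
    forall k, chain_pow k c = (zexpg x J ^+ k)%g.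
  elim: c {cK} cx => [|e c IH] cx.
    exists 0; rewrite /chain_eval big_nil mul0r; split => // k.
    by rewrite /chain_pow big_nil /= expg0 expg1n.
  have [|J [evJ powJ]] := IH.
    by move=> e' e'c; apply: cx; rewrite inE e'c orbT.
  have := cx e (mem_head _ _); case: e {cx} => -[a r] i /= [-> ->].
  exists (i + J); rewrite chain_eval_cons evJ intrD mulrDl; split=> // k.
  rewrite chain_pow_cons powJ /= zexpgD expgMn //; exact: zexpg_commute.
have s0 : 0 <= s by exact: scl_ge0.
(* A chain over the single point x amounts to J x; as inversion preserves length, a filling of x^(J
   k) also fills x^(|J| k). *)
suff : `|J|%:~R * s <= t.
  by apply: le_trans; rewrite evJ ler_wpM2r // ler_int ler_norm.
apply: (@le_slope _ _ _ K) => k; have [n nP nK] := cK k.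
apply: le_trans nK; rewrite powJ in nP.
have {}nP : GNprod N n (val x ^+ (`|J| * k))%g.
  move: nP; rewrite val_expg; case: J {evJ powJ} => j /=.
    by rewrite val_expg -expgnA.
  by move=> /(GNprodV nN); rewrite val_inv val_expg expVgn invgK -expgnA.
have := (sclP xP).2 (`|J| * k)%N; rewrite -/s natrM natr_absz.
have : (cl N (val x ^+ (`|J| * k))%g <= n)%N by apply: (clP _).2 => //; exists n.
rewrite -(ler_nat R); lra.
Qed.

End SclBounds.

(** * Defects and homogeneity *)

Section Defect.
Variables (R : realType) (N : groupType).
Implicit Types (f : N -> R) (a b : N).

Lemma defect_le f (D : R) :
  (defect f <= D%:E)%E <-> forall a b, `|f (a * b)%g - f a - f b| <= D.
Proof.
split=> [fD a b|fD]; last by apply: ge_ereal_sup => _ [[a b] _ <-]; rewrite lee_fin /=.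
rewrite -lee_fin (le_trans _ fD) //; apply: ereal_sup_ubound.
by exists (a, b).
Qed.

Lemma defect_ge0 f : (0 <= defect f)%E.
Proof.
apply: (@le_trans _ _ `|f (1 * 1)%g - f 1%g - f 1%g|%:E); first by rewrite lee_fin.
by apply: ereal_sup_ubound; exists (1%g, 1%g).
Qed.

Lemma quasimorphism_defect f :
  quasimorphism f -> defect f = (fine (defect f))%:E.
Proof. by move=> fq; rewrite fineK // ge0_fin_numE // defect_ge0. Qed.

Lemma quasimorphism_fine f a b :
  quasimorphism f -> `|f (a * b)%g - f a - f b| <= fine (defect f).
Proof. by move=> /quasimorphism_defect fE; move: a b; apply/defect_le; rewrite -fE. Qed.

Lemma homomorphism_defect f :
  quasimorphism f -> fine (defect f) = 0 -> homomorphism f.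
Proof.
move=> fq f0 a b; have := quasimorphism_fine a b fq.
by rewrite f0 normr_le0 -addrA -opprD subr_eq0 => /eqP.
Qed.

Lemma homomorphism_defect0 f : homomorphism f -> defect f = 0%E.
Proof.
move=> fh; apply/eqP; rewrite eq_le defect_ge0 andbT.
by apply/defect_le => a b; rewrite fh addrAC addrK subrr normr0.
Qed.

Lemma homogeneousV f a : homogeneous f -> f a^-1%g = - f a.
Proof. by move=> fh; have := fh a (- 1); rewrite /= expg1 mulN1r. Qed.

Lemma homogeneousX f a n : homogeneous f -> f (a ^+ n)%g = n%:R * f a.
Proof. by move=> fh; exact: (fh a n). Qed.

Lemma homomorphism_homogeneous f : homomorphism f -> homogeneous f.
Proof.
move=> fh; have f1 : f 1%g = 0.
  have := fh 1%g 1%g; rewrite mulg1 => /eqP.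
  by rewrite -subr_eq0 opprD addNKr oppr_eq0 => /eqP.
have fX a n : f (a ^+ n)%g = n%:R * f a.
  by elim: n => [|n IH]; rewrite ?expg0 ?mul0r // expgS fh IH mulrSr; ring.
move=> a [n|n] /=; first exact: fX.
have := fh (a ^+ n.+1)%g (a ^- n.+1)%g; rewrite mulgV f1 fX NegzE mulrNz mulNr.
by rewrite -pmulrn => fE; lra.
Qed.

End Defect.

(** * Duality between quasimorphisms and fillings *)

Section Duality.
Variables (R : realType) (G : groupType) (P : pred G) (N : subGroupType P).
Variable nN : normal_subgroup N.
Implicit Types (f : N -> R) (x a b : N).

Lemma conjNX g a n : (conjN nN g a ^+ n)%g = conjN nN g (a ^+ n)%g.
Proof. by apply: val_inj; rewrite val_expg !val_conjN val_expg expg_conj. Qed.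

(** On k-th powers the deviation is multiplied by k but stays bounded. *)
Lemma Qh_Ginvariant f : Qh R nN f -> Ginvariant nN f.
Proof.
move=> [_ fh fG] g a; pose K := fine (ereal_sup
  [set (`|f (conjN nN p.1 p.2) - f p.2|)%:E | p in [set: G * N]]).
have fK h b : `|f (conjN nN h b) - f b| <= K.
  rewrite -lee_fin fineK; first by apply: ereal_sup_ubound; exists (h, b).
  rewrite ge0_fin_numE //; apply: (@le_trans _ _ `|f (conjN nN h b) - f b|%:E).
    by rewrite lee_fin.
  by apply: ereal_sup_ubound; exists (h, b).
apply/eqP; rewrite -subr_eq0 -normr_le0; apply: (@le_slope _ _ _ K) => k.
rewrite mul0r add0r (le_trans _ (fK g (a ^+ k)%g)) // -conjNX !homogeneousX //.
by rewrite -mulrBr normrM normr_nat mulrC.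
Qed.

(** Each factor costs 2 D(f): one D(f) for the value at (g h g^-1) h^-1, where the two terms cancel
    by invariance, and one for splitting the product. *)
Lemma Qh_GNprod f n a : Qh R nN f -> GNprod N n (val a) ->
  `|f a| <= (2 * n)%:R * fine (defect f).
Proof.
move=> fQ; have [fq fh _] := fQ; set D := fine _.
have fD b c : `|f (b * c)%g - f b - f c| <= D by exact: quasimorphism_fine.
elim: n a => [|n IH] a.
  case=> c _; rewrite big_ord0 -(val1 N) => /val_inj ->.
  by rewrite mul0r normr_le0; have := fh 1%g 0; rewrite /= expg0 mul0r => ->.
move=> /GNprodS[_ [z [[g [h ->]] zP az]]].
pose b := (conjN nN g h * h^-1)%g.
have bE : val b = comm g (val h) by rewrite valM val_inv val_conjN.
have zE : z = val (b^-1 * a)%g by rewrite valM val_inv bE az mulKg.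
have := IH (b^-1 * a)%g; rewrite -zE => /(_ zP) IHa.
have := fD b (b^-1 * a)%g; rewrite mulVKg.
have := fD (conjN nN g h) h^-1%g;
rewrite -/b (Qh_Ginvariant fQ) homogeneousV // opprK subrK.
move: IHa; rewrite !ler_norml mulnS natrD mulrDl.
move=> /andP[? ?] /andP[? ?] /andP[? ?]; apply/andP; split; lra.
Qed.

Lemma Qh_scl f x : Qh R nN f -> (exists n, GNprod N n (val x)) ->
  `|f x| <= 2 * fine (defect f) * scl N R (val x).
Proof.
move=> fQ xP; have [sl _] := sclP R xP; have [_ fh _] := fQ.
set D := fine _.
have D0 : 0 <= D by rewrite fine_ge0 ?defect_ge0.
have : (2 * D * ((cl N (val x ^+ n)%g)%:R / n%:R)) @[n --> \oo] -->
    2 * D * scl N R (val x).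
  by apply: cvgM sl; exact: cvg_cst.
move=> /[dup] cD /cvg_lim <- //; apply: limr_ge.
  by apply/cvg_ex; eexists; exact: cD.
near=> n; have n0 : (0 < n)%N by near: n; exact: nbhs_infty_gt.
rewrite mulrA ler_pdivlMr ?ltr0n // -[`|f x| * _]mulrC.
rewrite -[n%:R]normr_nat -normrM -homogeneousX //.
have [m xm] := xP.
have : GNprod N (cl N (val x ^+ n)%g) (val (x ^+ n)%g).
  by rewrite val_expg; apply: (clP _).1; exists (n * m)%N; exact: GNprodX.
by move=> /(Qh_GNprod fQ); rewrite natrM -/D; lra.
Unshelve. all: by end_near.
Qed.

Lemma H1_sub_Qh : H1 R nN `<=` Qh R nN.
Proof.
move=> f [fh fG]; split; first by rewrite /quasimorphism homomorphism_defect0.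
  exact: homomorphism_homogeneous.
apply: (@le_lt_trans _ _ 0%E) => //; apply: ge_ereal_sup => _ [[g a] _ <-] /=.
by rewrite fG subrr normr0.
Qed.

Lemma dominated_Qh f : dominated (N := N) [set p | p.2 = f p.1] ->
  Qh R nN f /\ (defect f <= (2^-1)%:E)%E.
Proof.
move=> domf; pose term a n := (a, f a, n) : N * R * int.
(* The opposite chain has the same filling bounds, so domination is two-sided. *)
have dom (c : seq (N * R * int)) t :
    {in c, forall e, e.1.2 = f e.1.1} -> filling_bound c t -> `|chain_eval c| <= t.
  move=> cf ct; rewrite ler_norml lerNl -chain_eval_opp.
  apply/andP; split; apply: domf => //.
    exact: chain_over_opp.
  exact: filling_bound_opp.
have fh : homogeneous f.
  move=> a n; apply/eqP; rewrite -subr_eq0 -normr_le0.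
  have -> : f (zexpg a n) - n%:~R * f a =
      chain_eval [:: term (zexpg a n) 1; term a (- n)].
    by rewrite !chain_eval_cons /chain_eval big_nil mulrNz /=; ring.
  apply: dom => [e|]; first by rewrite !inE => /orP[]/eqP->.
  apply: (@filling_bound0 _ _ _ _ _ 0) => k.
  rewrite !chain_pow_cons zexpgN expVgn /= expg1 mulVKg /chain_pow big_nil val1.
  exact: GNprod0.
have fG : Ginvariant nN f.
  move=> g a; apply/eqP; rewrite -subr_eq0 -normr_le0.
  have -> : f (conjN nN g a) - f a =
      chain_eval [:: term (conjN nN g a) 1; term a (- 1)].
    by rewrite !chain_eval_cons /chain_eval big_nil mulrNz /=; ring.
  apply: dom => [e|]; first by rewrite !inE => /orP[]/eqP->.
  (* For every k the filling is the single commutator [g, a^k]. *)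
  apply: (@filling_bound0 _ _ _ _ _ 1) => k; apply: GNprod1.
  rewrite !chain_pow_cons zexpgN expVgn /= !expg1 /chain_pow big_nil mulg1 conjNX.
  by exists g, (a ^+ k)%g; rewrite valM val_inv val_conjN.
have fD : (defect f <= (2^-1)%:E)%E.
  (* The order b, a is chosen so that (b a)^-1 = a^-1 b^-1 matches [GNprod_pants]; the coefficients
     2 supply its even exponents. *)
  apply/defect_le => b a.
  suff : `|f a + f b - f (b * a)%g| * 2 <= 1.
    have -> : f (b * a)%g - f b - f a = - (f a + f b - f (b * a)%g) by ring.
    by rewrite normrN; lra.
  have -> : `|f a + f b - f (b * a)%g| * 2 =
      `|chain_eval [:: term a 2; term b 2; term (b * a)%g (- 2)]|.
    rewrite !chain_eval_cons /chain_eval big_nil mulrNz /=.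
    rewrite -[X in _ * X](@normr_nat R 2) -normrM.
    by congr (`| _ |); ring.
  apply: dom => [e|]; first by rewrite !inE => /or3P[]/eqP->.
  exists 0 => k; exists k; last by rewrite mul1r addr0.
  have := GNprod_pants nN a b k; rewrite -invgM.
  rewrite !chain_pow_cons zexpgN /= /chain_pow big_nil mulg1.
  by rewrite -!expgnA !expVgn -expgnA !mul2n mulgA.
split=> //; split=> //; first exact: le_lt_trans fD (ltry _).
apply: (@le_lt_trans _ _ 0%E) => //; apply: ge_ereal_sup => _ [[g a] _ <-] /=.
by rewrite fG subrr normr0.
Qed.

End Duality.

Theorem theorem1p2 (R : realType) (G : groupType) (P : pred G)
    (N : subGroupType P) (nN : normal_subgroup N)
    (x : N) (hx : GNcommg N (val x)) :
  (scl N R (val x))%:E =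
    if `[< Qh R nN = H1 R nN >] then 0%E
    else ((2^-1)%:E *
          ereal_sup [set (`|f x| / fine (defect f))%:E
                    | f in Qh R nN `\` H1 R nN])%E.
Proof.
have xP := GNcommgP nN hx.
set s := scl N R (val x).
have s0 : 0 <= s by exact: scl_ge0.
have [f [fx domf]] := dominated_total nN (dominated_scl (R := R) nN xP).
have {}fx : f x = s by exact: fx.
have [fQ fD] := dominated_Qh nN domf.
have fH1 : H1 R nN f -> s = 0.
  move=> [fh _]; apply/eqP; rewrite -fx -normr_le0 (le_trans (Qh_scl fQ xP)) //.
  by rewrite homomorphism_defect0 //= mulr0 mul0r.
case: asboolP => [QH|QH]; first by rewrite fH1 // -QH.
(* Every quotient in the supremum has a nonzero denominator, since zero defect would put h in
   [H1]. *)
have pos h : (Qh R nN `\` H1 R nN) h -> 0 < fine (defect h).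
  move=> [hQ hH]; rewrite lt_neqAle fine_ge0 ?defect_ge0 // andbT eq_sym.
  apply/eqP => h0; apply: hH; split; last exact: Qh_Ginvariant.
  by apply: homomorphism_defect h0; case: hQ.
set A := [set _ | _ in _].
have supA : ereal_sup A = (2 * s)%:E.
  apply/eqP; rewrite eq_le; apply/andP; split.
    apply: ge_ereal_sup => _ [h hQH <-]; rewrite lee_fin ler_pdivrMr ?pos //.
    by rewrite mulrAC; apply: Qh_scl => //; case: hQH.
  (* If s = 0, f may lie in [H1], but any admissible h gives a quotient >= 0; otherwise f itself is
     admissible and its quotient is at least 2 s. *)
  have [s_eq0|/negP sN0] := boolP (s == 0).
    have [h hQH] : (Qh R nN `\` H1 R nN) !=set0.
      apply/set0P/eqP; rewrite setD_eq0 => QsubH; apply: QH; apply/seteqP.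
      by split => //; exact: H1_sub_Qh.
    apply: (@le_trans _ _ (`|h x| / fine (defect h))%:E).
      by rewrite lee_fin (eqP s_eq0) mulr0 divr_ge0 // ltW ?pos.
    by apply: ereal_sup_ubound; exists h.
  have fQH : (Qh R nN `\` H1 R nN) f by split => // /fH1/eqP.
  apply: (@le_trans _ _ (`|f x| / fine (defect f))%:E).
    rewrite lee_fin ler_pdivlMr ?pos // fx ger0_norm //.
    have : fine (defect f) <= 2^-1.
      by rewrite -lee_fin -quasimorphism_defect //; case: fQ.
    nra.
  by apply: ereal_sup_ubound; exists f.
by rewrite supA -EFinM mulKf.
Qed.
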